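(* Every proof in $\mathsf{LNGL}$ can be transformed into a proof in normal form.
   Context: A linear nested sequent is $\Gamma_{1} \vdash \Delta_{1} \mathbin{/\!/} \cdots \mathbin{/\!/} \Gamma_{n} \vdash \Delta_{n}$ with formula multisets $\Gamma_i,\Delta_i$ (formulae built from atoms by $\neg,\lor,\Box$). The calculus $\mathsf{LNGL}$ has rules ($\mathcal{G}$ a possibly empty prefix): $\mathsf{id_1}$: $\mathcal{G} \mathbin{/\!/} \Gamma, p \vdash p, \Delta$; $\mathsf{id_2}$: $\mathcal{G} \mathbin{/\!/} \Gamma, \Box\phi \vdash \Box\phi, \Delta$; local rules $\lor\mathsf{L}$: from $\mathcal{G} \mathbin{/\!/} \Gamma, \phi \vdash \Delta$ and $\mathcal{G} \mathbin{/\!/} \Gamma, \psi \vdash \Delta$ infer $\mathcal{G} \mathbin{/\!/} \Gamma, \phi\lor\psi \vdash \Delta$; $\lor\mathsf{R}$: from $\mathcal{G} \mathbin{/\!/} \Gamma \vdash \phi,\psi,\Delta$ infer $\mathcal{G} \mathbin{/\!/} \Gamma \vdash \phi\lor\psi,\Delta$; $\neg\mathsf{L}$: from $\mathcal{G} \mathbin{/\!/} \Gamma \vdash \phi,\Delta$ infer $\mathcal{G} \mathbin{/\!/} \Gamma,\neg\phi \vdash \Delta$; $\neg\mathsf{R}$: from $\mathcal{G} \mathbin{/\!/} \Gamma,\phi \vdash \Delta$ infer $\mathcal{G} \mathbin{/\!/} \Gamma \vdash \neg\phi,\Delta$; propagation rules $\mathsf{4L}$: from $\mathcal{G} \mathbin{/\!/}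 \Gamma,\Box\phi \vdash \Delta \mathbin{/\!/} \Sigma,\Box\phi \vdash \Pi$ infer $\mathcal{G} \mathbin{/\!/} \Gamma,\Box\phi \vdash \Delta \mathbin{/\!/} \Sigma \vdash \Pi$; $\Box\mathsf{L}$: from $\mathcal{G} \mathbin{/\!/} \Gamma,\Box\phi \vdash \Delta \mathbin{/\!/} \Sigma,\phi \vdash \Pi$ infer $\mathcal{G} \mathbin{/\!/} \Gamma,\Box\phi \vdash \Delta \mathbin{/\!/} \Sigma \vdash \Pi$; and $\Box\mathsf{R}$: from $\mathcal{G} \mathbin{/\!/} \Gamma \vdash \Delta \mathbin{/\!/} \Box\phi \vdash \phi$ infer $\mathcal{G} \mathbin{/\!/} \Gamma \vdash \Box\phi,\Delta$. A block is a derivation using only rules from a given set. An $\mathsf{LNGL}$ proof is in normal form iff, reading bottom-up, each $\Box\mathsf{R}$ application with premise $\mathcal{G} \mathbin{/\!/} \Gamma \vdash \Delta \mathbin{/\!/} \Box\phi \vdash \phi$ has that premise derived by a block of $\mathsf{4L}$ rules from some $\mathcal{G} \mathbin{/\!/} \Gamma \vdash \Delta \mathbin{/\!/} \Gamma', \Box\phi \vdash \phi$, which is derived by a block of $\Box\mathsf{L}$ rules from some $\mathcal{G} \mathbin{/\!/} \Gamma \vdash \Delta \mathbin{/\!/} \Gamma', \Gamma'', \Box\phi \vdash \phi$, which is derived by a block of local rules from premises of the form $\mathcal{G} \mathbin{/\!/} \Gamma \vdash \Delta \mathbin{/\!/} \Sigma_i \vdash \Pi_i$ (each of which is an initial sequent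 or the conclusion of a further $\Box\mathsf{R}$). *)

(* Defs.v *)
From HB Require Import structures.
From Stdlib Require List.
From mathcomp Require Import all_boot.
From mathcomp Require Import finmap multiset.

Set Implicit Arguments.
Unset Strict Implicit.
Unset Printing Implicit Defensive.

Local Open Scope mset_scope.

Inductive form (A : Type) : Type :=
| Atom of A
| Neg of form A
| Or of form A & form A
| Box of form A.

(* A choiceType structure on formulae, needed to form {mset form A}. *)
Section FormChoice.
Context {A : choiceType}.

Fixpoint form_encode (f : form A) : GenTree.tree A :=
  match f with
  | Atom p => GenTree.Leaf p
  | Neg g => GenTree.Node 0 [:: form_encode g]
  | Or g h => GenTree.Node 1 [:: form_encode g; form_encode h]
  | Box g => GenTree.Node 2 [:: form_encode g]
  end.

Fixpoint form_decode (t : GenTree.tree A) : option (form A) :=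
  match t with
  | GenTree.Leaf p => Some (Atom p)
  | GenTree.Node 0 [:: u] => omap (@Neg A) (form_decode u)
  | GenTree.Node 1 [:: u; v] =>
      obind (fun g => omap (Or g) (form_decode v)) (form_decode u)
  | GenTree.Node 2 [:: u] => omap (@Box A) (form_decode u)
  | _ => None
  end.

Lemma form_encodeK : pcancel form_encode form_decode.
Proof. by elim=> //= [g ->|g -> h ->|g ->]. Qed.

HB.instance Definition _ := Equality.copy (form A) (pcan_type form_encodeK).
HB.instance Definition _ := Choice.copy (form A) (pcan_type form_encodeK).
End FormChoice.

(* (X, Y) is the sequent X |- Y. *)
Definition sequent (A : choiceType) : Type :=
  ({mset form A} * {mset form A})%type.

(* The components of a linear nested sequent, leftmost first; a prefix G
   followed by a last component s is [rcons G s]. The empty list is not a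
   linear nested sequent, but it is useful as the empty prefix, and no rule
   below has it as premise or conclusion. *)
Definition lns (A : choiceType) : Type := seq (sequent A).

Inductive rule : Type :=
| Id1 | Id2 | OrL | OrR | NegL | NegR | FourL | BoxL | BoxR.

Definition initial_rule (r : rule) : bool :=
  match r with Id1 | Id2 => true | _ => false end.

Definition local_rule (r : rule) : bool :=
  match r with OrL | OrR | NegL | NegR => true | _ => false end.

Definition is_FourL (r : rule) : bool := if r is FourL then true else false.
Definition is_BoxL (r : rule) : bool := if r is BoxL then true else false.
Definition is_BoxR (r : rule) : bool := if r is BoxR then true else false.

(* [inference r Ss S]: S follows from the list of premises Ss by r. *)
Inductive inference (A : choiceType) : rule -> seq (lns A) -> lns A -> Prop :=
| inf_Id1 (G : lns A) (X Y : {mset form A}) (p : A) :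
    inference Id1 [::] (rcons G (Atom p +` X, Atom p +` Y))
| inf_Id2 (G : lns A) (X Y : {mset form A}) (f : form A) :
    inference Id2 [::] (rcons G (Box f +` X, Box f +` Y))
| inf_OrL (G : lns A) (X Y : {mset form A}) (f g : form A) :
    inference OrL [:: rcons G (f +` X, Y); rcons G (g +` X, Y)]
      (rcons G (Or f g +` X, Y))
| inf_OrR (G : lns A) (X Y : {mset form A}) (f g : form A) :
    inference OrR [:: rcons G (X, f +` (g +` Y))]
      (rcons G (X, Or f g +` Y))
| inf_NegL (G : lns A) (X Y : {mset form A}) (f : form A) :
    inference NegL [:: rcons G (X, f +` Y)]
      (rcons G (Neg f +` X, Y))
| inf_NegR (G : lns A) (X Y : {mset form A}) (f : form A) :
    inference NegR [:: rcons G (f +` X, Y)]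
      (rcons G (X, Neg f +` Y))
| inf_FourL (G : lns A) (X Y Z W : {mset form A}) (f : form A) :
    inference FourL
      [:: rcons (rcons G (Box f +` X, Y)) (Box f +` Z, W)]
      (rcons (rcons G (Box f +` X, Y)) (Z, W))
| inf_BoxL (G : lns A) (X Y Z W : {mset form A}) (f : form A) :
    inference BoxL
      [:: rcons (rcons G (Box f +` X, Y)) (f +` Z, W)]
      (rcons (rcons G (Box f +` X, Y)) (Z, W))
| inf_BoxR (G : lns A) (X Y : {mset form A}) (f : form A) :
    inference BoxR
      [:: rcons (rcons G (X, Y)) ([mset Box f], [mset f])]
      (rcons G (X, Box f +` Y)).

Inductive tree (A : choiceType) : Type :=
| Node of rule & lns A & seq (tree A).

Definition root_rule (A : choiceType) (t : tree A) : rule :=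
  let: Node r _ _ := t in r.
Definition concl (A : choiceType) (t : tree A) : lns A :=
  let: Node _ C _ := t in C.
Definition children (A : choiceType) (t : tree A) : seq (tree A) :=
  let: Node _ _ ts := t in ts.

Inductive correct (A : choiceType) : tree A -> Prop :=
| correct_Node r S ts :
    inference r [seq concl t | t <- ts] S ->
    (forall t, List.In t ts -> correct t) ->
    correct (Node r S ts).

Definition proof_of (A : choiceType) (t : tree A) (S : lns A) : Prop :=
  correct t /\ concl t = S.

Inductive subproof (A : choiceType) (u : tree A) : tree A -> Prop :=
| subproof_refl : subproof u u
| subproof_child r S ts t :
    List.In t ts -> subproof u t -> subproof u (Node r S ts).

(* [block R Q t]: t ends with a possibly empty block of rules from R, and the
   subproof of every premise of this block satisfies Q. *)
Inductive block (A : choiceType) (R : rule -> bool) (Q : tree A -> Prop) :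
  tree A -> Prop :=
| block_premise t : Q t -> block R Q t
| block_rule r S ts :
    R r -> (forall t, List.In t ts -> block R Q t) -> block R Q (Node r S ts).

(* The sequents at the borders of the three blocks need not be mentioned: above
   G // X |- Y // []f |- f, the rules 4L, []L and the local rules leave all
   components but the last one unchanged, and 4L and []L only add formulae to
   the left-hand side of the last one. *)
Definition normal_premise (A : choiceType) (t : tree A) : Prop :=
  block is_FourL
    (block is_BoxL
      (block local_rule
        (fun u => initial_rule (root_rule u) || is_BoxR (root_rule u)))) t.

Definition normal_form (A : choiceType) (t : tree A) : Prop :=
  forall u, subproof u t -> is_BoxR (root_rule u) ->
  forall v, List.In v (children u) -> normal_premise v.

(* Main.v *)
Require Import Defs.
From Stdlib Require List.
From mathcomp Require Import all_boot.
From mathcomp Require Import finmap multiset.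

Set Implicit Arguments.
Unset Strict Implicit.
Unset Printing Implicit Defensive.

Local Open Scope mset_scope.

(** Every rule other than []R acts on the last component only, and the component
    to its left, from which 4L and []L take their formulae, does not change as
    long as the last component exists. All applications of 4L and []L in that
    component can therefore be moved down to the point where the component was
    created: the formulae that they add in the various branches are added there
    at once, and the rest of the proof is weakened by them. Weakening keeps the
    shape of a proof, hence also its normal form. *)

(* The position of a rule in the order of blocks, from the bottom upwards. *)
Definition rule_level (r : rule) : nat :=
  match r with
  | FourL => 0
  | BoxL => 1
  | OrL | OrR | NegL | NegR => 2
  | Id1 | Id2 | BoxR => 3
  end.

(** Going upwards, levels never decrease except above [BoxR], where a new component starts its own
    blocks. *)
Definition premise_level (r : rule) : nat :=
  if is_BoxR r then 0 else rule_level r.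

(* Level 0 corresponds to [normal_premise], level 2 to a block of local rules. *)
Inductive normal_derivable (A : choiceType) : nat -> lns A -> Prop :=
| NormalDerivable k r Ss S :
    inference r Ss S -> k <= rule_level r ->
    (forall S', List.In S' Ss -> normal_derivable (premise_level r) S') ->
    normal_derivable k S.

(** All components may grow, since [BoxR], read upwards, turns a weakened last component into an
    inner one. *)
Inductive left_weakening (A : choiceType) : lns A -> lns A -> Prop :=
| left_weakening_nil : left_weakening [::] [::]
| left_weakening_rcons G G' X Y M :
    left_weakening G G' ->
    left_weakening (rcons G (X, Y)) (rcons G' (M `+` X, Y)).

Definition boxes_and_bodies (A : choiceType) (fs : seq (form A)) :
    {mset form A} :=
  seq_mset [seq Box f | f <- fs] `+` seq_mset fs.

(** The default is an empty sequent, so nothing is boxed in an empty prefix, where [FourL] and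
    [BoxL] cannot act. *)
Definition boxed_in_last (A : choiceType) (G : lns A) (f : form A) : bool :=
  Box f \in (last (mset0, mset0) G).1.

Lemma seq_mset_cons (K : choiceType) (x : K) (s : seq K) :
  seq_mset (x :: s) = x +` seq_mset s.
Proof.
by apply/msetP => y; rewrite mset1DE !mset_seqE /= eq_sym.
Qed.

Lemma seq_mset_cat (K : choiceType) (s1 s2 : seq K) :
  seq_mset (s1 ++ s2) = seq_mset s1 `+` seq_mset s2.
Proof.
by apply/msetP => y; rewrite msetE2 !mset_seqE count_cat.
Qed.

Section NormalForm.
Context {A : choiceType}.
Implicit Types (S T G : lns A) (X Y Z W M : {mset form A}).
Implicit Types (f : form A) (fs : seq (form A)) (t : tree A).

(** * Admissibility of weakening on the left *)

Lemma left_weakening_refl S : left_weakening S S.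
Proof.
elim/last_ind: S => [|G [X Y] IH]; first exact: left_weakening_nil.
by rewrite -{2}[X]mset0D; apply: left_weakening_rcons.
Qed.

Lemma left_weakening_rconsE G X Y T :
  left_weakening (rcons G (X, Y)) T ->
  exists G' M, left_weakening G G' /\ T = rcons G' (M `+` X, Y).
Proof.
move ES: (rcons G (X, Y)) => S wST.
case: wST ES => [/(congr1 size)|G0 G' X0 Y0 M wG].
  by rewrite size_rcons.
by move=> /rcons_inj[-> -> ->]; exists G', M.
Qed.

(** Added formulae join the arbitrary context of the rule, in premises and conclusion alike. *)
Lemma inference_left_weakening r Ss S T :
  inference r Ss S -> left_weakening S T ->
  exists2 Ts, inference r Ts T &
    forall T', List.In T' Ts ->
    exists2 S', List.In S' Ss & left_weakening S' T'.
Proof.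
case=> {r Ss S} [G X Y p|G X Y f|G X Y f g|G X Y f g|G X Y f|G X Y f
  |G X Y Z W f|G X Y Z W f|G X Y f] /left_weakening_rconsE[G' [M [wG ->]]].
- by rewrite msetDCA; exists [::]; [exact: inf_Id1|].
- by rewrite msetDCA; exists [::]; [exact: inf_Id2|].
- rewrite msetDCA; eexists; first exact: inf_OrL.
  move=> T' /= [<-|[<-|[]]]; rewrite msetDCA; eexists.
  + by left.
  + exact: left_weakening_rcons.
  + by right; left.
  + exact: left_weakening_rcons.
- eexists; first exact: inf_OrR.
  move=> T' /= [<-|[]]; eexists; first by left.
  exact: left_weakening_rcons.
- rewrite msetDCA; eexists; first exact: inf_NegL.
  move=> T' /= [<-|[]]; eexists; first by left.
  exact: left_weakening_rcons.
- eexists; first exact: inf_NegR.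
  move=> T' /= [<-|[]]; rewrite msetDCA; eexists; first by left.
  exact: left_weakening_rcons.
- have [G0 [N [wG0 ->]]] := left_weakening_rconsE wG.
  rewrite msetDCA; eexists; first exact: inf_FourL.
  move=> T' /= [<-|[]]; rewrite (msetDCA _ N) (msetDCA _ M).
  eexists; first by left.
  by do 2!apply: left_weakening_rcons.
- have [G0 [N [wG0 ->]]] := left_weakening_rconsE wG.
  rewrite msetDCA; eexists; first exact: inf_BoxL.
  move=> T' /= [<-|[]]; rewrite (msetDCA _ N) (msetDCA _ M).
  eexists; first by left.
  by do 2!apply: left_weakening_rcons.
- eexists; first exact: inf_BoxR.
  move=> T' /= [<-|[]]; eexists; first by left.
  (* The component that [BoxR] creates is fixed, so its weakening is by the empty multiset. *)
  rewrite -{2}[ [mset Box f] ]mset0D.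
  by do 2!apply: left_weakening_rcons.
Qed.

Lemma normal_derivable_left_weakening k S T :
  normal_derivable k S -> left_weakening S T -> normal_derivable k T.
Proof.
move=> dS; elim: dS T => {k S} k r Ss S inf_r le_k _ IH T wST.
have [Ts inf_T wTs] := inference_left_weakening inf_r wST.
apply: (NormalDerivable inf_T le_k) => T' /wTs[S' inS' wS'].
exact: IH wS'.
Qed.

Lemma normal_derivable_weaken_last k G X Y M :
  normal_derivable k (rcons G (X, Y)) ->
  normal_derivable k (rcons G (M `+` X, Y)).
Proof.
move=> /normal_derivable_left_weakening; apply.
by apply: left_weakening_rcons; exact: left_weakening_refl.
Qed.

Lemma normal_derivable_leq j k S :
  j <= k -> normal_derivable k S -> normal_derivable j S.
Proof.
move=> le_jk dS; case: dS le_jk => {k S} k r Ss S inf_r le_k dSs le_jk.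
exact: NormalDerivable inf_r (leq_trans le_jk le_k) dSs.
Qed.

Lemma normal_derivable_unary k r S T :
  inference r [:: S] T -> k <= rule_level r ->
  normal_derivable (premise_level r) S -> normal_derivable k T.
Proof.
by move=> inf_r le_k dS; apply: (NormalDerivable inf_r le_k) => S' /= [<-|[]].
Qed.

(** * Blocks of propagation rules *)

Lemma boxed_in_lastP G f :
  boxed_in_last G f -> exists G' X Y, G = rcons G' (Box f +` X, Y).
Proof.
rewrite /boxed_in_last; case/lastP: G => [|G [X Y]].
  by rewrite /= in_mset0.
rewrite last_rcons /= => /msetB1K <-.
by exists G, (X `\ Box f), Y.
Qed.

Lemma boxed_in_last_rcons G X Y f :
  boxed_in_last (rcons G (Box f +` X, Y)) f.
Proof. by rewrite /boxed_in_last last_rcons mset1D1. Qed.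

Lemma normal_derivable_box_block G fs Z W :
  all (boxed_in_last G) fs ->
  normal_derivable 1 (rcons G (seq_mset fs `+` Z, W)) ->
  normal_derivable 1 (rcons G (Z, W)).
Proof.
elim: fs Z => [|f fs IH] Z /=; first by rewrite -enum_mset0 seq_mset_id mset0D.
case/andP=> /boxed_in_lastP[G' [X [Y eG]]] all_fs.
(* [f] joins [Z]: the induction hypothesis handles [fs], and the [BoxL] for [f] goes below. *)
rewrite seq_mset_cons msetDAC msetDC => /(IH _ all_fs).
by rewrite eG; exact: normal_derivable_unary (inf_BoxL _ _ _ _ _ _) _.
Qed.

Lemma normal_derivable_four_block G fs Z W :
  all (boxed_in_last G) fs ->
  normal_derivable 0 (rcons G (seq_mset [seq Box f | f <- fs] `+` Z, W)) ->
  normal_derivable 0 (rcons G (Z, W)).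
Proof.
elim: fs Z => [|f fs IH] Z /=; first by rewrite -enum_mset0 seq_mset_id mset0D.
case/andP=> /boxed_in_lastP[G' [X [Y eG]]] all_fs.
rewrite seq_mset_cons msetDAC msetDC => /(IH _ all_fs).
by rewrite eG; exact: normal_derivable_unary (inf_FourL _ _ _ _ _ _) _.
Qed.

Lemma normal_derivable_propagation_blocks G fs Z W :
  all (boxed_in_last G) fs ->
  normal_derivable 2 (rcons G (boxes_and_bodies fs `+` Z, W)) ->
  normal_derivable 0 (rcons G (Z, W)).
Proof.
(* The [BoxL] block lies above the [FourL] block, so the bodies are removed before the boxes. *)
move=> all_fs; rewrite /boxes_and_bodies -msetDA msetDCA.
move=> /(normal_derivable_leq (leqnSn 1)) /(normal_derivable_box_block all_fs).
by move=> /(normal_derivable_leq (leqnSn 0)) /(normal_derivable_four_block all_fs).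
Qed.

(** * Moving propagation down to the creation of a component *)

Lemma boxes_and_bodies_cons f fs :
  boxes_and_bodies (f :: fs) = (Box f +` (f +` boxes_and_bodies fs)).
Proof.
rewrite /boxes_and_bodies /= !seq_mset_cons msetDACA -!msetDA.
by congr (_ `+` _).
Qed.

Lemma boxes_and_bodies_cat fs1 fs2 :
  boxes_and_bodies (fs1 ++ fs2) = boxes_and_bodies fs1 `+` boxes_and_bodies fs2.
Proof. by rewrite /boxes_and_bodies map_cat !seq_mset_cat msetDACA. Qed.

(* [fs] collects the formulae of all applications of 4L and []L to the last
   component. Both [Box f] and [f] are added for each of them, so that one list
   serves for both rules. *)
Lemma correct_normal_derivable t G Z W :
  correct t -> concl t = rcons G (Z, W) ->
  exists2 fs, all (boxed_in_last G) fs &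
    normal_derivable 2 (rcons G (boxes_and_bodies fs `+` Z, W)).
Proof.
move=> ct; elim: ct G Z W => {t} r S ts inf_r _ IH G Z W /= eS.
have {}IH S' : List.In S' [seq concl t | t <- ts] ->
    forall G0 Z0 W0, S' = rcons G0 (Z0, W0) ->
    exists2 fs, all (boxed_in_last G0) fs &
      normal_derivable 2 (rcons G0 (boxes_and_bodies fs `+` Z0, W0)).
  by move=> /List.in_map_iff[u [<- inu]] *; apply: IH inu _ _ _ _.
have prem0 S0 Ss G0 Z0 W0 : [seq concl t | t <- ts] = S0 :: Ss ->
    S0 = rcons G0 (Z0, W0) -> exists2 fs, all (boxed_in_last G0) fs &
      normal_derivable 2 (rcons G0 (boxes_and_bodies fs `+` Z0, W0)).
  by move=> eSs; apply: IH; rewrite eSs; left.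
have b0 : boxes_and_bodies [::] = mset0 :> {mset form A}.
  by rewrite /boxes_and_bodies /= -enum_mset0 seq_mset_id mset0D.
move: (erefl [seq concl t | t <- ts]) eS; case: _ {-1}_ _ / inf_r.
- move=> G0 X Y p _ /rcons_inj[<- <- <-]; exists [::] => //.
  by rewrite b0 mset0D; apply: NormalDerivable (inf_Id1 _ _ _ _) _ _.
- move=> G0 X Y f _ /rcons_inj[<- <- <-]; exists [::] => //.
  by rewrite b0 mset0D; apply: NormalDerivable (inf_Id2 _ _ _ _) _ _.
- move=> G0 X Y f g eSs /rcons_inj[<- <- <-].
  have [fs1 all1 d1] := prem0 _ _ _ _ _ eSs erefl.
  have [|fs2 all2 d2] := IH (rcons G0 (g +` X, Y)) _ _ _ _ erefl.
    by rewrite eSs; right; left.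
  (* Each branch is weakened by the list of the other one. *)
  exists (fs1 ++ fs2); first by rewrite all_cat all1.
  rewrite boxes_and_bodies_cat msetDCA.
  apply: NormalDerivable (inf_OrL _ _ _ _ _) _ _ => // S' /= [<-|[<-|[]]].
  + rewrite msetDCA [boxes_and_bodies fs1 `+` _]msetDC -msetDA.
    exact: normal_derivable_weaken_last.
  + by rewrite msetDCA -msetDA; exact: normal_derivable_weaken_last.
- move=> G0 X Y f g eSs /rcons_inj[<- <- <-].
  have [fs all_fs d] := prem0 _ _ _ _ _ eSs erefl; exists fs => //.
  exact: normal_derivable_unary (inf_OrR _ _ _ _ _) _ d.
- move=> G0 X Y f eSs /rcons_inj[<- <- <-].
  have [fs all_fs d] := prem0 _ _ _ _ _ eSs erefl; exists fs => //.
  by rewrite msetDCA; exact: normal_derivable_unary (inf_NegL _ _ _ _) _ d.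
- move=> G0 X Y f eSs /rcons_inj[<- <- <-].
  have [fs all_fs d] := prem0 _ _ _ _ _ eSs erefl; exists fs => //.
  move: d; rewrite msetDCA.
  exact: normal_derivable_unary (inf_NegR _ _ _ _) _.
- move=> G0 X Y Z0 W0 f eSs /rcons_inj[<- <- <-].
  have [fs all_fs d] := prem0 _ _ _ _ _ eSs erefl.
  (* The [FourL] step disappears: its premise already has [Box f], and weakening adds the body [f].
     For [BoxL] the two roles are swapped. *)
  exists (f :: fs); first by rewrite /= boxed_in_last_rcons.
  rewrite boxes_and_bodies_cons msetDCA -msetDA.
  apply: normal_derivable_weaken_last.
  by rewrite -msetDA msetDCA.
- move=> G0 X Y Z0 W0 f eSs /rcons_inj[<- <- <-].
  have [fs all_fs d] := prem0 _ _ _ _ _ eSs erefl.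
  exists (f :: fs); first by rewrite /= boxed_in_last_rcons.
  rewrite boxes_and_bodies_cons -msetDA.
  apply: normal_derivable_weaken_last.
  by rewrite -msetDA msetDCA.
- move=> G0 X Y f eSs /rcons_inj[<- <- <-].
  (* [fs] belongs to the new component and is spent in blocks right above this [BoxR]. The old last
     component is not acted on above it, so its list is empty. *)
  have [fs all_fs d] := prem0 _ _ _ _ _ eSs erefl; exists [::] => //.
  rewrite b0 mset0D; apply: normal_derivable_unary (inf_BoxR _ _ _ _) _ _ => //.
  exact: normal_derivable_propagation_blocks all_fs d.
Qed.

(** * From derivability to proof trees *)

Definition blocks_from (k : nat) t : Prop :=
  let leaf u := initial_rule (root_rule u) || is_BoxR (root_rule u) in
  match k with
  | 0 => normal_premise t
  | 1 => block is_BoxL (block local_rule leaf) t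
  | 2 => block local_rule leaf t
  | _ => leaf t
  end.

(** Holds because every block may be empty. *)
Lemma blocks_from_leq j k t : j <= k -> blocks_from k t -> blocks_from j t.
Proof.
have step i : blocks_from i.+1 t -> blocks_from i t.
  by case: i => [|[|[|i]]] //; apply: block_premise.
elim: k => [|k IH]; first by rewrite leqn0 => /eqP ->.
by rewrite leq_eqVlt => /predU1P[-> //|le_jk] /step; apply: IH.
Qed.

Lemma trees_of_concls (P : tree A -> Prop) (Ss : seq (lns A)) :
  (forall S, List.In S Ss -> exists2 t, concl t = S & P t) ->
  exists2 ts, [seq concl t | t <- ts] = Ss & forall t, List.In t ts -> P t.
Proof.
elim: Ss => [|S Ss IH] ex; first by exists [::].
have [|t et Pt] := ex S; first by left.
have [S' inS'|ts ets Pts] := IH; first by apply: ex; right.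
by exists (t :: ts); [rewrite /= et ets | move=> u [<-|/Pts]].
Qed.

(** The three properties are built together: normal form at a [BoxR] root is the block shape of its
    child at level 0. *)
Lemma normal_derivable_tree k S :
  normal_derivable k S ->
  exists2 t, concl t = S & [/\ correct t, normal_form t & blocks_from k t].
Proof.
elim=> {k S} k r Ss S inf_r le_k _ /trees_of_concls[ts eSs tsP].
exists (Node r S ts) => //; split.
- by constructor; [rewrite eSs | move=> t /tsP[]].
- move=> u sub_u; move Et: (Node r S ts) sub_u => t sub_u.
  case: sub_u Et => [<- /= r_BoxR v /tsP[_ _]|r' S' ts' u' in_u' sub_u [er _ ets]].
    by rewrite /premise_level r_BoxR.
  by rewrite -ets in in_u'; have [_ nf_u' _] := tsP _ in_u'; exact: nf_u'.
- apply: blocks_from_leq le_k _.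
  by case: r {inf_r} tsP => tsP //=; apply: block_rule => // t /tsP[].
Qed.

End NormalForm.

Theorem theorem4p10 (A : choiceType) (S : lns A) (t : tree A) :
  proof_of t S -> exists t' : tree A, proof_of t' S /\ normal_form t'.
Proof.
case=> ct; case/lastP: S => [|G [Z W]] et.
  case: ct et => r S ts inf_r _ /= eS; exfalso.
  by case: inf_r eS => > /(congr1 size); rewrite size_rcons.
(* No [BoxR] of the proof created the last component of the end sequent, so its propagation blocks
   go at the root. *)
have [fs all_fs d] := correct_normal_derivable ct et.
have [t' et' [ct' nf_t' _]] :=
  normal_derivable_tree (normal_derivable_propagation_blocks all_fs d).
by exists t'.
Qed.
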